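(* Let $G$ be a connected graph on at least two vertices and let $\ell$ denote the maximum length of a path in $G$. Then $\mathrm{lpt}(G)\le \ell^{1/2+o(1)}$, where the $o(1)$ term tends to $0$ as $\ell\to\infty$, uniformly over all such $G$. That is: for every $\varepsilon>0$ there exists $\ell_0=\ell_0(\varepsilon)$ such that every connected graph $G$ on at least two vertices whose maximum path length $\ell$ satisfies $\ell\ge \ell_0$ satisfies $\mathrm{lpt}(G)\le \ell^{1/2+\varepsilon}$.
   Context: Graphs are finite and simple. The length of a path is its number of edges. A longest path in $G$ is a path of maximum length in $G$. A longest path transversal in $G$ is a set of vertices of $G$ that intersects the vertex set of every longest path in $G$, and $\mathrm{lpt}(G)$ denotes the minimum size of a longest path transversal in $G$. *)

(* Defs.v *)
From mathcomp Require Import all_boot.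

Set Implicit Arguments.
Unset Strict Implicit.
Unset Printing Implicit Defensive.

Section LongestPaths.
Context {T : finType}.

Definition simple_graph (e : rel T) : Prop := symmetric e /\ irreflexive e.

Definition connected_graph (e : rel T) : Prop := forall x y : T, connect e x y.

Variable e : rel T.

(* A path is the nonempty sequence of its pairwise distinct vertices. *)
Definition is_path (p : seq T) : bool := [&& p != [::], sorted e p & uniq p].

Definition path_length (p : seq T) : nat := (size p).-1.

(* The bound n < #|T| only serves to make the range finite: see leq_max_path. *)
Definition max_path_length : nat :=
  \max_(n < #|T| | [exists p : n.+1.-tuple T, is_path p]) n.

Definition longest_path (p : seq T) : bool :=
  is_path p && (path_length p == max_path_length).

(* Longest paths are the p with max_path_length.+1 vertices, so ranging over
   tuples loses none of them: see lp_transversalP. *)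
Definition lp_transversal (S : {set T}) : bool :=
  [forall p : max_path_length.+1.-tuple T,
     longest_path p ==> [exists v in S, v \in val p]].

(* The full vertex set is always a transversal (lp_transversalT), so the
   arg min below is a genuine minimum. *)
Definition lpt : nat := #|[arg min_(S < [set: T] | lp_transversal S) #|S|]|.

Lemma leq_max_path (p : seq T) : is_path p -> path_length p <= max_path_length.
Proof.
case: p => [|x p]; first by rewrite /is_path.
move=> hp; have hu : uniq (x :: p) by case/and3P: hp.
have hs : size p < #|T| by rewrite -[(size p).+1]/(size (x :: p)) -(card_uniqP hu) max_card.
rewrite /path_length /=.
apply: (@leq_bigmax_cond _ _ (fun n : 'I_#|T| => n : nat) (Ordinal hs)).
by apply/existsP; exists (in_tuple (x :: p)).
Qed.

Lemma exists_longest_path : 0 < #|T| -> exists p, longest_path p.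
Proof.
move=> T0; have [x _] := card_gt0P T0.
have hc : 0 < #|[pred n : 'I_#|T| | [exists p : n.+1.-tuple T, is_path p]]|.
  apply/card_gt0P; exists (Ordinal T0); rewrite inE.
  by apply/existsP; exists [tuple x].
have [i /existsP [p hp] hi] := eq_bigmax_cond (fun n : 'I_#|T| => n : nat) hc.
exists p; rewrite /longest_path hp /path_length size_tuple /=.
by apply/eqP; symmetry.
Qed.

Lemma longest_pathP (p : seq T) :
  reflect (is_path p /\ forall q, is_path q -> path_length q <= path_length p)
          (longest_path p).
Proof.
apply: (iffP andP) => [[hp /eqP ->]|[hp hm]]; first by split=> // q /leq_max_path.
split=> //; rewrite eqn_leq leq_max_path //=.
have T0 : 0 < #|T| by case: p hp {hm} => // x p _; apply/card_gt0P; exists x.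
by have [q /andP [hq /eqP <-]] := exists_longest_path T0; apply: hm.
Qed.

Lemma lp_transversalP (S : {set T}) :
  reflect (forall p, longest_path p -> exists2 v, v \in S & v \in p)
          (lp_transversal S).
Proof.
apply: (iffP forallP) => [h p hp | h p]; last first.
  by apply/implyP => /h [v vS vp]; apply/existsP; exists v; rewrite vS.
have hs : size p == max_path_length.+1.
  by case/andP: hp; case: p => // x p _; rewrite eqSS.
have /implyP /(_ hp) /existsP [v /andP [vS vp]] := h (Tuple hs).
by exists v.
Qed.

Lemma lp_transversalT : lp_transversal [set: T].
Proof.
apply/lp_transversalP => -[|x p] //= _.
by exists x; rewrite ?in_setT ?mem_head.
Qed.

Lemma lpt_leq (S : {set T}) : lp_transversal S -> lpt <= #|S|.
Proof.
by rewrite /lpt; case: arg_minnP => [|A _ hA /hA //]; apply: lp_transversalT.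
Qed.

Lemma lpt_attained : exists2 S : {set T}, lp_transversal S & #|S| = lpt.
Proof.
rewrite /lpt; case: arg_minnP => [|A hA _]; first exact: lp_transversalT.
by exists A.
Qed.

End LongestPaths.

(* Main.v *)
Require Import Defs.
From mathcomp Require Import all_boot all_order all_algebra.
From mathcomp Require Import reals exp.
From mathcomp Require Import ring lra zify.
From mathcomp Require boolp.

Set Implicit Arguments.
Unset Strict Implicit.
Unset Printing Implicit Defensive.

(** Write [l] for the maximum length of a path and [k] for [lpt e]; the proof
    shows that [k] is at most of order [sqrt l * log l] ([lpt_bound]).

    The weight of a vertex sequence is the least size of a set that meets every
    longest path meeting the sequence.  It is subadditive, at most the number of
    vertices, and at least [k] on a longest path, because any two longest paths
    of a connected graph meet.  If the weight of [s] is less than [k], some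
    longest path avoids [s]: such an [s] is called light.

    By Menger's theorem a vertex set [U] of weight [r] disjoint from a longest
    path [Y] is joined to [Y] by [r] disjoint paths, the rungs ([rungs]).  The
    path [Y] cannot be lengthened by leaving it along one rung, crossing [U] and
    returning along another one, so two rungs land on [Y] at a distance that
    exceeds their lengths plus the length of the crossing ([rungs_spread]).  As
    [Y] has only [l] edges, two facts follow when [v] is of order [sqrt l]:
    - a light cycle has weight less than [v], since otherwise its longer arcs
      would serve as crossings between [v] rungs ([light_cycle]);
    - of [v] rungs, one has at most [v] inner vertices ([short_rung]).

    Hence light connected subgraphs look like trees at every scale from [v] to
    [k], and trees branch.  Start with a light path of weight a few times [v] and
    a longest path [Y] that avoids it.  From two places of the path that are
    separated by a part of weight [v], short rungs lead to [Y]; continuing along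
    [Y] for a few times [v] in weight gives two new paths, each of which can be
    grown again, with another [Y].  After [m] rounds there are [2 ^ m] paths of
    weight [O(m v)], which are light together in pairs if [k] exceeds a multiple
    of [m v].  All of them can be ended on one fixed longest path [W], with
    pairwise different ends, since two paths that branch and meet again would
    close a light cycle of weight at least [v] ([binary_tree]).  So
    [2 ^ m <= l + 1], which fails for [m] slightly larger than [log2 l]. *)

(** * Menger's theorem *)

Section Menger.
Context {T : finType}.

(** With walks in place of paths, parts of different walks can be concatenated
    without removing repetitions. *)
Definition separates (e : rel T) (A B S : {set T}) : Prop :=
  forall x p, x \in A -> path e x p -> last x p \in B -> has [in S] (x :: p).

Definition links (e : rel T) (A B : {set T}) (p : seq T) : bool :=
  if p is x :: p' then [&& x \in A, last x p' \in B, path e x p' & uniq p]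
  else false.

Lemma sorted_glue (e : rel T) s1 z s2 :
  sorted e (s1 ++ z :: s2) = sorted e (rcons s1 z) && sorted e (z :: s2).
Proof.
case: s1 => [|a s1] //=.
by rewrite cat_path rcons_path /= andbA.
Qed.

Lemma mem_split (z : T) s : z \in s -> exists s1 s2, s = s1 ++ z :: s2.
Proof. by case/splitPr => s1 s2; exists s1, s2. Qed.

Lemma injective_onto r (h : 'I_r -> T) (X : {set T}) :
  injective h -> (forall i, h i \in X) -> #|X| = r ->
  forall x, x \in X -> exists i, h i = x.
Proof.
move=> h_inj hX cX x xX.
have sub : [set h i | i : 'I_r] \subset X.
  by apply/subsetP => _ /imsetP [i _ ->].
have : [set h i | i : 'I_r] == X.
  by rewrite eqEcard sub card_imset // card_ord cX leqnn.
by move/eqP => E; move: xX; rewrite -E => /imsetP [i _ ->]; exists i.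
Qed.

Lemma linksP e A B p x0 : links e A B p ->
  [/\ head x0 p \in A, last x0 p \in B, sorted e p, uniq p & p = head x0 p :: behead p].
Proof. by case: p => // x p /and4P [? ? ? ?]; split. Qed.

Lemma first_hit (X : {set T}) x p : has [in X] (x :: p) ->
  exists p1 p2, [/\ p = p1 ++ p2, last x p1 \in X & ~~ has [in X] (belast x p1)].
Proof.
elim: p x => [|y p IH] x /=; first by rewrite orbF => xX; exists [::], [::].
have [xX _|xX /IH [p1 [p2 [-> lX bX]]]] := boolP (x \in X).
  by exists [::], (y :: p).
by exists (y :: p1), p2; rewrite /= negb_or xX.
Qed.

Lemma last_hit (X : {set T}) x p : has [in X] (x :: p) ->
  exists p1 p2, [/\ p = p1 ++ p2, last x p1 \in X & ~~ has [in X] p2].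
Proof.
elim: p x => [|y p IH] x; first by rewrite /= orbF => xX; exists [::], [::].
have [/IH [p1 [p2 [-> lX bX]]] _|nX] := boolP (has [in X] (y :: p)).
  by exists (y :: p1), p2.
by rewrite -cat1s has_cat (negbTE nX) /= !orbF => xX; exists [::], (y :: p).
Qed.

(** Induction on the number of arcs.  If deleting the arc from [x] to [y] creates
    a separator [S] with fewer than [r] vertices, then [x |: S] and [y |: S]
    separate [A] from [B] in the original graph and so have exactly [r] elements.
    By induction [r] disjoint paths lead from [A] to [x |: S] and [r] disjoint
    paths from [y |: S] to [B] without the arc; as [S] separates, the two families
    meet only in [S], and they are glued there and along the arc. *)
Theorem menger (e : rel T) (A B : {set T}) r :
  (forall S, separates e A B S -> r <= #|S|) ->
  exists f : 'I_r -> seq T,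
    (forall i, links e A B (f i)) /\
    (forall i j z, z \in f i -> z \in f j -> i = j).
Proof.
have [n] := ubnP #|[set a : T * T | e a.1 a.2]|.
elim: n e A B r => // n IH e A B r; rewrite ltnS => le_n rS.
have [[x y] exy | noarc] := pickP [pred a : T * T | e a.1 a.2]; last first.
  have rAB : r <= #|A :&: B|.
    apply: rS => x [|y p] xA /=; first by rewrite inE xA => _ ->.
    by have := noarc (x, y); rewrite /= => ->.
  exists (fun i => [:: enum_val (widen_ord rAB i)]); split=> [i|i j z].
    have := enum_valP (widen_ord rAB i); rewrite inE => /andP [? ?].
    by apply/and4P.
  rewrite !inE => /eqP -> /eqP /enum_val_inj /(congr1 val) /= ?.
  exact: val_inj.
rewrite /= in exy.
pose e' := [rel u w | e u w && ((u, w) != (x, y))].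
have e'e : subrel e' e by move=> u w /andP [].
have lt_e' : #|[set a : T * T | e' a.1 a.2]| < n.
  apply: leq_trans le_n; apply: proper_card; apply/properP; split.
    by apply/subsetP => a; rewrite !inE => /andP [].
  by exists (x, y); rewrite !inE /= ?exy ?eqxx.
have [[S [sepS ltS]] | noS] :=
    boolp.EM (exists S, separates e' A B S /\ #|S| < r); last first.
  have [S sepS|f [f_links f_disj]] := IH e' A B r lt_e'.
    by rewrite leqNgt; apply/negP => ltS; apply: noS; exists S.
  exists f; split=> // i; move: (f_links i); rewrite /links.
  case: (f i) => // u p /and4P [uA lB pe' up].
  by apply/and4P; split=> //; apply: sub_path pe'.
have sep1 z : z \in [set x; y] -> separates e A B (z |: S).
  move=> zxy u p uA pe lB.
  have [pe'|npe'] := boolP (path e' u p).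
    by apply: sub_has (sepS u p uA pe' lB) => w /=; rewrite !inE => ->; rewrite orbT.
  suff : z \in u :: p by move=> zp; apply/hasP; exists z => //=; apply: setU11.
  elim: p u {uA lB} pe npe' => //= w p IHp u /andP [euw pe].
  have [[-> ->] _|neq npe'] := eqVneq (u, w) (x, y).
    by move: zxy; rewrite !inE => /orP [] /eqP ->; rewrite eqxx ?orbT.
  rewrite in_cons IHp ?orbT //.
  by apply: contra npe' => pe'; apply/andP; split=> //; apply/andP.
have card1 z : z \in [set x; y] -> #|z |: S| = r /\ z \notin S.
  move=> zxy; have rz := rS _ (sep1 z zxy).
  have := cardsU1 z S; case: (boolP (z \in S)) => /= zS E.
    by move: rz; rewrite E leqNgt ltS.
  by split=> //; apply/eqP; rewrite eqn_leq rz E ltS.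
have [cx xS] : #|x |: S| = r /\ x \notin S by apply: card1; rewrite !inE eqxx.
have [cy yS] : #|y |: S| = r /\ y \notin S by apply: card1; rewrite !inE eqxx orbT.
have [S' sepS'|f [f_links f_disj]] := IH e' A (x |: S) r lt_e'.
  apply: rS => u p uA pe lB.
  (* The part of an A-B walk up to its first vertex in x |: S never uses the
     removed arc, which starts at x. *)
  have [|p1 [p2 [Ep lX bX]]] := @first_hit (x |: S) u p.
    by apply: sep1; rewrite ?inE ?eqxx.
  have pe1 : path e' u p1.
    move: pe bX; rewrite Ep cat_path => /andP [pe1 _] {Ep lX uA lB}.
    elim: p1 u pe1 => //= w p1 IHp u /andP [euw pe1].
    rewrite negb_or => /andP [uX /(IHp _ pe1) ->]; rewrite andbT euw xpair_eqE.
    by apply: contra uX => /andP [/eqP -> _]; apply: setU11.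
  have := sepS' _ _ uA pe1 lX; rewrite Ep -cat_cons has_cat => ->.
  by [].
have [S' sepS'|g [g_links g_disj]] := IH e' (y |: S) B r lt_e'.
  apply: rS => u p uA pe lB.
  (* Likewise for the part after the last vertex in y |: S, as the arc ends in y. *)
  have [|p1 [p2 [Ep lX bX]]] := @last_hit (y |: S) u p.
    by apply: sep1; rewrite ?inE ?eqxx ?orbT.
  have pe2 : path e' (last u p1) p2.
    move: pe bX; rewrite Ep cat_path => /andP [_ pe2] {Ep lX uA lB}.
    elim: p2 (last u p1) pe2 => //= w p2 IHp t /andP [etw pe2].
    rewrite negb_or => /andP [wX /(IHp _ pe2) ->]; rewrite andbT etw xpair_eqE.
    by apply: contra wX => /andP [_ /eqP ->]; apply: setU11.
  have lB2 : last (last u p1) p2 \in B by rewrite -last_cat -Ep.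
  have /hasP [w wp wS] := sepS' _ _ lX pe2 lB2; apply/hasP; exists w => //.
  by rewrite Ep -cat_cons (lastI u p1) cat_rcons mem_cat wp orbT.
have fP i := linksP x (f_links i); have gP i := linksP x (g_links i).
pose s i := last x (f i); pose t i := head x (g i).
have f_eq i j z : z \in f i -> z \in f j -> i = j := @f_disj i j z.
have g_eq i j z : z \in g i -> z \in g j -> i = j := @g_disj i j z.
have s_in i : s i \in f i by have [_ _ _ _ E] := fP i; rewrite /s E /= mem_last.
have t_in i : t i \in g i by have [_ _ _ _ ->] := gP i; rewrite mem_head.
have sX i : s i \in x |: S by have [] := fP i.
have tX i : t i \in y |: S by have [] := gP i.
have s_inj : injective s.
  by move=> i j E; apply: (@f_disj i j (s i)); rewrite // E.
have t_inj : injective t.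
  by move=> i j E; apply: (@g_disj i j (t i)); rewrite // E.
have s_onto := injective_onto s_inj sX cx.
have t_onto := injective_onto t_inj tX cy.
have s_only i z : z \in f i -> z \in x |: S -> z = s i.
  by move=> zf /s_onto [j E]; rewrite -E (f_disj i j z) // -E.
have t_only i z : z \in g i -> z \in y |: S -> z = t i.
  by move=> zf /t_onto [j E]; rewrite -E (g_disj i j z) // -E.
have SX z : z \in S -> z \in x |: S by move=> zS; rewrite inE zS orbT.
have SY z : z \in S -> z \in y |: S by move=> zS; rewrite inE zS orbT.
(* Following the i-th path to a common vertex z and then the j-th one gives an
   A-B walk without the arc; it meets S, and only z can be the place. *)
have meet i j z : z \in f i -> z \in g j -> [/\ z \in S, z = s i & z = t j].
  move=> zf zg; suff zS : z \in S by split; [|apply: s_only|apply: t_only]; auto.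
  have [fA _ pf uf Ef] := fP i; have [_ gB pg ug Eg] := gP j.
  have [a [b Eab]] := mem_split zf; have [c [d Ecd]] := mem_split zg.
  have wS : has [in S] (a ++ z :: d).
    have : sorted e' (a ++ z :: d).
      move: pf pg; rewrite Eab Ecd !(sorted_glue e').
      by move=> /andP [-> _] /andP [_ ->].
    have : head x (a ++ z :: d) \in A by move: fA; rewrite Eab; case: (a).
    have : last x (a ++ z :: d) \in B by move: gB; rewrite Ecd !last_cat.
    case E: (a ++ z :: d) => [|u p] /= lB uA pe; first by case: (a) E.
    exact: sepS.
  have {wS} [w] := hasP wS; rewrite /= mem_cat => wp wS.
  suff <- : w = z by [].
  case/orP: wp => [wa|].
    have wf : w \in f i by rewrite Eab mem_cat wa.
    have Ew := s_only _ _ wf (SX _ wS).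
    move: uf; rewrite Eab cat_uniq => /and3P [_ /hasPn /(_ w)].
    rewrite wa /= => nw _; exfalso.
    have /nw // : w \in z :: b by rewrite Ew /s Eab last_cat /= mem_last.
  rewrite inE => /orP [/eqP //|wd].
  have wg : w \in g j by rewrite Ecd mem_cat inE wd !orbT.
  have Ew := t_only _ _ wg (SY _ wS).
  move: ug; rewrite Ecd cat_uniq => /and3P [_ /hasPn nc].
  case: c Ecd nc => [|u c] Ecd nc /=.
    by move: Ew; rewrite /t Ecd.
  exfalso; have /nc /= : w \in z :: d by rewrite inE wd orbT.
  by rewrite Ew /t Ecd /= mem_head.
(* phi sends the end of a first path to the start of its continuation. *)
pose phi z := if z == x then y else z.
have phiX z : z \in x |: S -> phi z \in y |: S.
  by rewrite /phi !inE; case: (z == x) => //=; rewrite ?eqxx // => ->; rewrite orbT.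
have [sg sgE] : exists sg : 'I_r -> 'I_r, forall i, t (sg i) = phi (s i).
  exists (fun i => odflt i [pick j | t j == phi (s i)]) => i.
  case: pickP => [j /eqP //|no].
  by have [j E] := t_onto _ (phiX _ (sX i)); have := no j; rewrite E eqxx.
have sg_inj : injective sg.
  move=> i j E; apply: s_inj.
  have : phi (s i) = phi (s j) by rewrite -!sgE E.
  move: (sX i) (sX j); rewrite /phi !inE.
  case: (eqVneq (s i) x) => [->|_] /=; case: (eqVneq (s j) x) => [->|_] //= iS jS E'.
    by move: jS; rewrite -E' (negbTE yS).
  by move: iS; rewrite E' (negbTE yS).
pose h i := f i ++ (if s i == x then g (sg i) else behead (g (sg i))).
have h_sub i z : z \in h i -> z \in f i \/ z \in g (sg i).
  rewrite mem_cat => /orP [|]; [by left|right].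
  by move: b; case: ifP => // _ /mem_behead.
exists h; split=> [i|i j z].
  have [fA _ pf uf Ef] := fP i; have [_ gB pg ug Eg] := gP (sg i).
  have Eh : h i = head x (f i) :: (behead (f i) ++
      (if s i == x then g (sg i) else behead (g (sg i)))).
    by rewrite /h {1}Ef.
  have ls : last (head x (f i)) (behead (f i)) = s i by rewrite /s {3}Ef.
  have lt : last (t (sg i)) (behead (g (sg i))) = last x (g (sg i)).
    by rewrite /t {3}Eg.
  have pf' : path e (head x (f i)) (behead (f i)).
    by apply: (sub_path e'e); move: pf; rewrite {1}Ef.
  have pg' : path e (t (sg i)) (behead (g (sg i))).
    by apply: (sub_path e'e); move: pg; rewrite {1}Eg.
  have uh : uniq (h i).
    rewrite /h cat_uniq uf /=; apply/andP; split; last first.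
      by case: ifP => // _; apply: (subseq_uniq _ ug); rewrite {2}Eg subseq_cons.
    apply/hasPn => z zg; apply/negP => /= zf.
    move: zg; case: ifP => [/eqP sx|_] zg.
      by have [zS Es _] := meet _ _ _ zf zg; rewrite Es sx (negbTE xS) in zS.
    have [_ _ Et] := meet _ _ _ zf (mem_behead zg).
    by move: ug zg; rewrite {1}Eg /= Et => /andP [/negbTE ->].
  rewrite /links Eh -Eh uh andbT; apply/and3P; split=> //.
    rewrite last_cat ls; case: eqP => [_|/eqP sx]; first by rewrite Eg /= lt.
    by have := sgE i; rewrite /phi (negbTE sx) => <-; rewrite lt.
  rewrite cat_path pf' ls /=; have := sgE i; rewrite /phi.
  case: eqP => [->|_] E; last by rewrite -E.
  by rewrite Eg /= -/(t _) pg' E exy.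
move=> /h_sub [zi|zi] /h_sub [zj|zj].
- exact: f_disj zi zj.
- have [zS Es Et] := meet _ _ _ zi zj; apply: s_inj.
  rewrite -Es Et sgE /phi; case: eqP => // Ex.
  by rewrite Et sgE /phi Ex eqxx (negbTE yS) in zS.
- have [zS Es Et] := meet _ _ _ zj zi; apply: s_inj.
  rewrite -Es Et sgE /phi; case: eqP => // Ex.
  by rewrite Et sgE /phi Ex eqxx (negbTE yS) in zS.
- exact/sg_inj/(g_disj _ _ z).
Qed.
End Menger.

(** * Longest paths and weights *)

Section Basics.
Context {T : finType} (e : rel T).
Context (e_sym : symmetric e).
Context (e_conn : connected_graph e).

Lemma sorted_rev p : sorted e (rev p) = sorted e p.
Proof. by rewrite rev_sorted; apply: eq_sorted => x y; rewrite e_sym. Qed.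

Lemma longest_size p : longest_path e p -> size p = (max_path_length e).+1.
Proof. by case/andP; case: p => // x p _ /eqP <-. Qed.

Lemma longest_sorted p : longest_path e p -> sorted e p.
Proof. by case/andP => /and3P []. Qed.

Lemma longest_uniq p : longest_path e p -> uniq p.
Proof. by case/andP => /and3P []. Qed.

Lemma size_path_leq p : sorted e p -> uniq p -> size p <= (max_path_length e).+1.
Proof.
case: p => // x p sp up; rewrite ltnS.
by apply: (@leq_max_path _ e (x :: p)); apply/and3P.
Qed.

(** A walk between disjoint sets has a part that meets them only at its ends;
    this turns the paths given by Menger's theorem into rungs. *)
Lemma trim (r : rel T) (A B : {set T}) x p :
  [disjoint A & B] -> x \in A -> last x p \in B -> path r x p ->
  exists u inner q,
    [/\ u \in A, q \in B, path r u (rcons inner q), ~~ has [in A] inner &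
        ~~ has [in B] inner] /\
    subseq (u :: rcons inner q) (x :: p).
Proof.
move=> dAB xA lB pr.
have [|p1 [p2 [Ep uA nA]]] := @last_hit _ A x p; first by rewrite /= xA.
set u := last x p1 in uA.
have uB : u \notin B by rewrite (disjointFr dAB).
have lB2 : last u p2 \in B by rewrite -last_cat -Ep.
have [|p3 [p4 [Ep2 qB nB]]] := @first_hit _ B u p2.
  by apply/hasP; exists (last u p2); rewrite // mem_last.
have {pr} : path r u p2 by move: pr; rewrite Ep cat_path => /andP [].
rewrite Ep2 cat_path => /andP [pr _].
move: qB nB pr Ep2; case/lastP: p3 => [|inner q]; first by rewrite /= (negbTE uB).
rewrite last_rcons belast_rcons /= => qB /norP [_ nB] pr Ep2.
exists u, inner, q.
have sub : subseq (u :: rcons inner q) (x :: p).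
  rewrite Ep -cat_cons (lastI x p1) cat_rcons -[last x p1]/u.
  apply: subseq_trans (suffix_subseq _ _).
  by rewrite Ep2 -cat_cons prefix_subseq.
split=> //; split=> //.
by move: nA; rewrite Ep2 has_cat has_rcons !negb_or => /andP [/andP []].
Qed.

Lemma longer_half p u : sorted e p -> uniq p -> u \in p ->
  exists h, [/\ sorted e (rcons h u), uniq (rcons h u),
    {subset rcons h u <= p} & size p <= (size h).*2.+1].
Proof.
move=> sp up /mem_split [a [b Ep]].
have [ge|lt] := leqP (size b) (size a).
  exists a; split; last 1 first.
  - by rewrite Ep size_cat /=; lia.
  - by move: sp; rewrite Ep sorted_glue => /andP [].
  - by move: up; rewrite Ep -cat_rcons cat_uniq => /and3P [].
  - by move=> z za; rewrite Ep -cat_rcons mem_cat za.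
exists (rev b); rewrite -rev_cons; split.
- by rewrite sorted_rev; move: sp; rewrite Ep sorted_glue => /andP [].
- by rewrite rev_uniq; move: up; rewrite Ep cat_uniq => /and3P [].
- by move=> z; rewrite mem_rev Ep mem_cat => ->; rewrite orbT.
- by rewrite Ep size_cat size_rev /=; lia.
Qed.

(** Two disjoint longest paths could be joined by a connecting path; together
    with the longer halves at its ends it would form a longer path. *)
Lemma longest_meet p q : longest_path e p -> longest_path e q -> has [in q] p.
Proof.
move=> lp lq; apply/negPn/negP => dpq.
have {}dpq : [disjoint [set x in p] & [set x in q]].
  rewrite disjoint_subset; apply/subsetP => x; rewrite !inE => xp.
  by apply: contra dpq => xq; apply/hasP; exists x.
have [[p0 q0] [sp sq] [up uq]] : [/\ p != [::] /\ q != [::],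
    sorted e p /\ sorted e q & uniq p /\ uniq q].
  by case/andP: lp => /and3P [? ? ?] _; case/andP: lq => /and3P [? ? ?].
have [x xp] : exists x, x \in p by case: (p) p0 => // x s; exists x; rewrite mem_head.
have [y yq] : exists y, y \in q by case: (q) q0 => // y s; exists y; rewrite mem_head.
have /connectP [w pw Ey] := e_conn x y.
case/shortenP: pw Ey => w' pw' uw' _ Ey.
have [||u [i [v [[uP vQ pr nA nB] sub]]]] := trim dpq _ _ pw'; rewrite ?inE -?Ey //.
move: uP vQ; rewrite !inE => uP vQ.
have ui : uniq (u :: rcons i v) by apply: subseq_uniq sub _.
have [h [sh uh hp hsz]] := longer_half sp up uP.
have [g [sg ug gq gsz]] := longer_half sq uq vQ.
have snew : sorted e (rcons h u ++ i ++ rev (rcons g v)).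
  rewrite rev_rcons catA sorted_glue -rev_rcons sorted_rev sg andbT.
  by rewrite cat_rcons rcons_cat /= sorted_glue sh.
have disj z : z \in p -> z \in q -> False.
  move=> zp zq; have := disjointFr dpq (_ : z \in [set x in p]).
  by rewrite !inE zp zq => /(_ isT).
have unew : uniq (rcons h u ++ i ++ rev (rcons g v)).
  rewrite !cat_uniq uh rev_uniq ug andbT /=; apply/and3P; split.
  - apply/hasPn => z /=; rewrite mem_cat mem_rev => /orP [zi|/gq zq].
      apply/negP => /hp zp; move/hasPn: nA => /(_ _ zi).
      by rewrite /= inE zp.
    by apply/negP => /hp zp; apply: disj zp zq.
  - by move: ui; rewrite /= rcons_uniq => /and3P [].
  - apply/hasPn => z /=; rewrite mem_rev => /gq zq; apply/negP => zi.
    by move/hasPn: nB => /(_ _ zi); rewrite /= inE zq.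
move: hsz gsz (size_path_leq snew unew).
rewrite (longest_size lp) (longest_size lq) !size_cat size_rev !size_rcons.
by move: (size h) (size i) (size g) (max_path_length e); clear; lia.
Qed.

(** A cover may lie off [s], so a long sequence has small weight if a small set
    separates it from some longest path. *)
Definition covers (A : {set T}) (s : seq T) : bool :=
  [forall p : (max_path_length e).+1.-tuple T,
     longest_path e p ==> has [in s] p ==> has [in A] p].

Lemma coversP (A : {set T}) s :
  reflect (forall p, longest_path e p -> has [in s] p -> has [in A] p) (covers A s).
Proof.
apply: (iffP forallP) => [h p lp|h p]; last by apply/implyP => lp; apply/implyP; apply: h.
have sp : size p == (max_path_length e).+1 by rewrite (longest_size lp).
by have /implyP /(_ lp) /implyP := h (Tuple sp).
Qed.

Lemma coversT s : covers setT s.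
Proof.
by apply/coversP => p lp /hasP [x xp _]; apply/hasP; exists x => //=; apply: in_setT.
Qed.

Definition weight (s : seq T) : nat := #|[arg min_(A < [set: T] | covers A s) #|A|]|.

Lemma weight_attained s : exists2 A, covers A s & #|A| = weight s.
Proof.
rewrite /weight; case: arg_minnP => [|A cA _]; first exact: coversT.
by exists A.
Qed.

Lemma weight_leq A s : covers A s -> weight s <= #|A|.
Proof. by rewrite /weight; case: arg_minnP => [|B _ hB /hB]; first exact: coversT. Qed.

Lemma weight_sub s1 s2 : {subset s1 <= s2} -> weight s1 <= weight s2.
Proof.
move=> sub; have [A cA <-] := weight_attained s2; apply: weight_leq.
apply/coversP => p lp /hasP [x xp /sub xs].
by move/coversP: cA; apply=> //; apply/hasP; exists x.
Qed.

Lemma weight_cat s1 s2 : weight (s1 ++ s2) <= weight s1 + weight s2.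
Proof.
have [A cA <-] := weight_attained s1; have [B cB <-] := weight_attained s2.
apply: leq_trans (leq_card_setU A B); apply: weight_leq.
apply/coversP => p lp /hasP [x xp /=]; rewrite mem_cat => /orP [] xs.
  have /hasP [w wp wA] : has [in A] p.
    by move/coversP: cA; apply=> //; apply/hasP; exists x.
  by apply/hasP; exists w; rewrite // inE; apply/orP; left.
have /hasP [w wp wB] : has [in B] p.
  by move/coversP: cB; apply=> //; apply/hasP; exists x.
by apply/hasP; exists w; rewrite // inE; apply/orP; right.
Qed.

Lemma weight_size s : weight s <= size s.
Proof.
apply: leq_trans (card_size s).
rewrite -(eq_card (_ : [set x in s] =i s)); last by move=> x; rewrite inE.
apply: weight_leq; apply/coversP => p lp /hasP [x xp xs].
by apply/hasP; exists x; rewrite // inE.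
Qed.

Lemma weight_longest p : longest_path e p -> lpt e <= weight p.
Proof.
move=> lp; have [A /coversP cA <-] := weight_attained p.
apply: lpt_leq; apply/lp_transversalP => q lq.
by have /hasP [x xq xA] := cA q lq (longest_meet lq lp); exists x.
Qed.

(** An optimal cover of [s] is too small to be a transversal, and a longest path
    that avoids the cover avoids [s]. *)
Lemma weight_avoid s : weight s < lpt e ->
  exists2 p, longest_path e p & ~~ has [in s] p.
Proof.
have [A /coversP cA <-] := weight_attained s => ltA.
have [p [lp nA]] : exists p, longest_path e p /\ ~~ has [in A] p.
  apply: boolp.contrapT => no.
  suff : lpt e <= #|A| by rewrite leqNgt ltA.
  apply: lpt_leq; apply/lp_transversalP => p lp.
  have [/hasP [x xp xA]|nA] := boolP (has [in A] p); first by exists x.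
  by exfalso; apply: no; exists p.
by exists p => //; apply: contra nA; apply: cA.
Qed.

End Basics.

(** * Rungs between a set and a longest path *)

Section Rungs.
Context {T : finType} (e : rel T).
Context (e_sym : symmetric e).
Context (e_conn : connected_graph e).
Let l := max_path_length e.

Lemma subwalk (r : rel T) s x y : symmetric r -> sorted r s -> x \in s -> y \in s ->
  exists p, [/\ path r x p, last x p = y & {subset x :: p <= s}].
Proof.
move=> r_sym ss xs ys.
have [c [sc cs yc]] : exists c,
    [/\ sorted r (x :: c), {subset x :: c <= s} & y \in x :: c].
  have [a [b Es]] := mem_split xs.
  have [yb|yb] := boolP (y \in x :: b).
    exists b; split=> //; first by move: ss; rewrite Es sorted_glue => /andP [].
    by move=> z; rewrite Es mem_cat => ->; rewrite orbT.
  exists (rev a); split.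
  - by rewrite -rev_rcons sorted_rev //; move: ss; rewrite Es sorted_glue => /andP [].
  - by move=> z; rewrite inE mem_rev Es mem_cat inE => /orP [] ->; rewrite ?orbT.
  - by move: ys; rewrite inE mem_rev Es mem_cat (negbTE yb) orbF => ->; rewrite orbT.
case/splitPl: yc sc cs => p1 p2 Ey sc cs; exists p1; split=> //.
  by move: sc; rewrite /= cat_path => /andP [].
by move=> z zp; apply: cs; rewrite -cat_cons mem_cat zp.
Qed.

Definition rung (U Y : seq T) (u : T) (i : seq T) (q : T) : Prop :=
  [/\ u \in U, q \in Y, path e u (rcons i q), uniq (u :: rcons i q) &
      ~~ has [in U] i /\ ~~ has [in Y] i].

(** Menger's theorem in the graph without [D].  A separator together with a
    cover of [D] is a cover of [U]: a longest path that meets [U] and avoids [D]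
    meets [Y], so it contains a walk from [U] to [Y]. *)
Lemma rungs (Y U D : seq T) r : longest_path e Y ->
  ~~ has [in Y] U -> ~~ has [in D] U -> weight e D + r <= weight e U ->
  exists (u q : 'I_r -> T) (inn : 'I_r -> seq T),
    [/\ forall i, rung U Y (u i) (inn i) (q i),
        forall i, ~~ has [in D] (rcons (inn i) (q i)) &
        forall i j z, z \in u i :: rcons (inn i) (q i) ->
          z \in u j :: rcons (inn j) (q j) -> i = j].
Proof.
move=> lY UY UD wUD.
pose r' := [rel a b | [&& e a b, a \notin D & b \notin D]].
have r'_sym : symmetric r' by move=> a b; rewrite /= e_sym; do 2!case: (_ \in D).
have r'_sorted s : sorted e s -> ~~ has [in D] s -> sorted r' s.
  elim: s => // a [|b s] IH // /andP [eab ss] /= /norP [aD nD]; rewrite eab aD.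
  by move: (nD) => /norP [-> _]; apply: IH.
pose A := [set x in U]; pose B := [set x in Y | x \notin D].
have [S sepS|f [f_links f_disj]] := @menger T r' A B r.
  have [CD cD wD] := weight_attained e D.
  suff cU : covers e (CD :|: S) U.
    have := leq_trans (weight_leq cU) (leq_card_setU _ _).
    by rewrite wD; move: wUD; clear; lia.
  apply/coversP => p lp pU.
  have [pD|pD] := boolP (has [in D] p).
    move/coversP: cD => /(_ p lp pD) /hasP [w wp wC].
    by apply/hasP; exists w; rewrite //= inE; apply/orP; left.
  have [x xp xU] := hasP pU.
  have [z zp zY] := hasP (longest_meet e_sym e_conn lp lY).
  have [w [pw lw sw]] := subwalk r'_sym (r'_sorted _ (longest_sorted lp) pD) xp zp.
  have /hasP [c cw cS] : has [in S] (x :: w).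
    apply: sepS pw _; first by rewrite inE.
    by rewrite lw inE zY; move/hasPn: pD => /(_ _ zp).
  by apply/hasP; exists c; rewrite //= ?sw // inE; apply/orP; right.
have dAB : [disjoint A & B].
  rewrite disjoint_subset; apply/subsetP => x; rewrite !inE => xU.
  by rewrite negb_and; move/hasPn: UY => /(_ _ xU) /= ->.
have [g gP] : exists g : 'I_r -> T * seq T * T, forall i,
    rung U Y (g i).1.1 (g i).1.2 (g i).2 /\
    ~~ has [in D] (rcons (g i).1.2 (g i).2) /\
    {subset (g i).1.1 :: rcons (g i).1.2 (g i).2 <= f i}.
  apply: (@fin_all_exists _ (fun=> T * seq T * T)%type (fun i t =>
    rung U Y t.1.1 t.1.2 t.2 /\ ~~ has [in D] (rcons t.1.2 t.2) /\
    {subset t.1.1 :: rcons t.1.2 t.2 <= f i})) => i; have := f_links i.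
  case: (f i) => // x p /and4P [xA lB pp up].
  have [u [s [q [[uA qB ps nA nB] sub]]]] := trim dAB xA lB pp.
  exists (u, s, q) => /=.
  move: uA qB; rewrite !inE => uU /andP [qY qD].
  have nD : ~~ has [in D] (rcons s q).
    elim: (rcons s q) (u) ps => //= b t IH a /andP [/and3P [_ _ bD] /IH /negbTE ->].
    by rewrite (negbTE bD).
  split; last by split=> // z zs; apply: (mem_subseq sub).
  split=> //; first by apply: sub_path ps => a b /andP [].
    exact: subseq_uniq sub up.
  split; first by apply: contra nA; apply: sub_has => z /=; rewrite inE.
  apply/hasPn => z zs; apply/negP => /= zY; move/hasPn: nB => /(_ _ zs) /=.
  by rewrite inE zY /=; move/hasPn: nD => ->; rewrite // mem_rcons inE zs orbT.
exists (fun i => (g i).1.1), (fun i => (g i).2), (fun i => (g i).1.2).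
split=> [i|i|i j z zi zj]; try by have [? []] := gP i.
by have [_ [_ si]] := gP i; have [_ [_ sj]] := gP j; apply: f_disj (si _ zi) (sj _ zj).
Qed.

Lemma detour Y1 a M b Y2 N :
  longest_path e (Y1 ++ a :: M ++ b :: Y2) ->
  path e a (rcons N b) -> uniq N -> ~~ has [in Y1 ++ a :: M ++ b :: Y2] N ->
  size N <= size M.
Proof.
set Y := _ ++ _ => lY pN uN dN.
have := size_path_leq (_ : sorted e (Y1 ++ a :: N ++ b :: Y2)).
have -> : sorted e (Y1 ++ a :: N ++ b :: Y2).
  have := longest_sorted lY; rewrite /Y (sorted_glue e Y1) (sorted_glue e Y1).
  case/andP=> -> /=; rewrite -!cat_rcons !cat_path pN !last_rcons.
  by case/andP.
have -> : uniq (Y1 ++ a :: N ++ b :: Y2).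
  have P : perm_eq (Y1 ++ a :: N ++ b :: Y2) (N ++ (Y1 ++ a :: b :: Y2)).
    rewrite -(cat_rcons a Y1 (N ++ b :: Y2)) -(cat_rcons a Y1 (b :: Y2)).
    by rewrite perm_catCA.
  rewrite (perm_uniq P) cat_uniq uN /=.
  have sub : subseq (Y1 ++ a :: b :: Y2) Y.
    by rewrite cat_subseq //= eqxx suffix_subseq.
  rewrite (subseq_uniq sub (longest_uniq lY)) andbT.
  apply/hasPn => z /(mem_subseq sub) zY; apply/negP => /= zN.
  by move/hasPn: dN => /(_ _ zN) /=; rewrite zY.
move=> /(_ isT isT); rewrite -(longest_size lY) /Y !size_cat /= !size_cat /=.
by move: (size Y1) (size Y2) (size N) (size M); clear; lia.
Qed.

(** Rerouting [Y] through two rungs and a connection of their feet in [U] cannot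
    make it longer, so the landing points are far apart on [Y]. *)
Lemma rungs_spread (Y U : seq T) r (u q : 'I_r -> T) (inn : 'I_r -> seq T) d :
  longest_path e Y -> ~~ has [in Y] U ->
  (forall i, rung U Y (u i) (inn i) (q i)) ->
  (forall i j z, z \in u i :: rcons (inn i) (q i) ->
     z \in u j :: rcons (inn j) (q j) -> i = j) ->
  (forall i j, i != j -> exists c, [/\ path e (u i) c, last (u i) c = u j,
     uniq (u i :: c), {subset u i :: c <= U} &
     d <= size (inn i) + size (inn j) + size c + 2]) ->
  r.-1 * d <= l.
Proof.
move=> lY UY rP disj conn.
pose pos i := index (q i) Y.
have qY i : q i \in Y by case: (rP i).
have lt_pos i : pos i < l.+1 by rewrite -(longest_size lY) index_mem.
have posD i j : pos i < pos j -> pos i + d <= pos j.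
  move=> ltij; have ne : i != j by apply: contraTneq ltij => ->; rewrite ltnn.
  have [c [pc lc uc cU dc]] := conn i j ne.
  have [Y1 [R E1]] := mem_split (qY i).
  have uY := longest_uniq lY.
  have posi : pos i = size Y1.
    move: uY; rewrite /pos E1 cat_uniq /= => /and3P [_ /norP [/negbTE nq _] _].
    by rewrite index_cat /= nq eqxx addn0.
  have [M [Y2 E2]] : exists M Y2, R = M ++ q j :: Y2.
    apply: mem_split; move: (qY j); rewrite E1 mem_cat inE => /or3P [|/eqP Eq|//].
      move=> qY1; move: ltij; rewrite posi /pos E1 index_cat qY1.
      by rewrite -index_mem in qY1; rewrite ltnNge (ltnW qY1).
    by move: ltij; rewrite /pos Eq ltnn.
  rewrite E2 in E1.
  have posj : pos j = size Y1 + (size M).+1.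
    move: uY; rewrite /pos E1 -cat_cons catA cat_uniq /=.
    move=> /and3P [_ /norP [/negbTE nq _] _].
    by rewrite index_cat nq /= eqxx addn0 size_cat.
  have [ui _ pi ri [iU iY]] := rP i; have [uj _ pj rj [jU jY]] := rP j.
  have := @detour Y1 (q i) M (q j) Y2 (rev (inn i) ++ (u i :: c) ++ inn j).
  rewrite -E1 => /(_ lY); rewrite !size_cat size_rev posi posj /=.
  have -> : path e (q i) (rcons (rev (inn i) ++ u i :: c ++ inn j) (q j)).
    rewrite rcons_cat /= rcons_cat.
    have : sorted e (rev (u i :: rcons (inn i) (q i))) by rewrite sorted_rev.
    rewrite rev_cons rev_rcons /= -cat_rcons cat_path => ->.
    rewrite last_rcons cat_path pc lc.
    exact: pj.
  have -> : uniq (rev (inn i) ++ u i :: c ++ inn j).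
    have [uni unj] : uniq (inn i) /\ uniq (inn j).
      by move: ri rj; rewrite /= !rcons_uniq => /and3P [_ _ ->] /and3P [_ _ ->].
    rewrite -cat_cons cat_uniq rev_uniq uni; apply/and3P; split=> //.
      apply/hasPn => z zz; rewrite /= mem_rev; apply/negP => zi.
      move: zz; rewrite mem_cat => /orP [zc|zj].
        by move/hasPn: iU => /(_ _ zi) /=; rewrite cU.
      by move: ne; rewrite (disj i j z) ?eqxx // inE mem_rcons inE ?zi ?zj ?orbT.
    rewrite cat_uniq uc unj andbT; apply/hasPn => z zz; apply/negP => zc.
    by move/hasPn: jU => /(_ _ zz) /=; rewrite cU.
  have -> : ~~ has [in Y] (rev (inn i) ++ u i :: c ++ inn j).
    rewrite -cat_cons !has_cat has_rev (negbTE iY) (negbTE jY) orbF orFb.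
    by apply: contra UY => /hasP [z /cU zU zY]; apply/hasP; exists z.
  move=> /(_ isT isT isT); move: dc.
  by move: (size Y1) (size M) (size (inn i)) (size (inn j)) (size c); clear; lia.
(* Positions at pairwise distance at least d have different quotients by d. *)
have [->|d0] := posnP d; first by rewrite muln0.
suff ler : r <= (l %/ d).+1.
  apply: leq_trans (leq_trunc_div l d); rewrite leq_mul2r.
  by apply/orP; right; move: ler; move: (l %/ d); clear; lia.
have ltq i : pos i %/ d < (l %/ d).+1 by rewrite ltnS leq_div2r // -ltnS lt_pos.
pose h i := Ordinal (ltq i).
have h_inj : injective h.
  move=> i j /(congr1 val) /= E; apply: (disj i j (q i)).
    by rewrite inE mem_rcons mem_head orbT.
  suff -> : q i = q j by rewrite inE mem_rcons mem_head orbT.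
  suff Ep : pos i = pos j.
    have := nth_index (q i) (qY i); rewrite -[index _ _]/(pos i) Ep.
    by rewrite [pos j]/pos nth_index // => ->.
  have := divn_eq (pos i) d; have := divn_eq (pos j) d; rewrite E.
  have := ltn_pmod (pos i) d0; have := ltn_pmod (pos j) d0.
  have := posD i j; have := posD j i.
  move: (pos i %% d) (pos j %% d) (pos j %/ d * d) (pos i) (pos j).
  by clear; lia.
by have := leq_card h h_inj; rewrite !card_ord.
Qed.

Lemma longer_arc Z x y : cycle e Z -> uniq Z -> x \in Z -> y \in Z -> x != y ->
  exists c, [/\ path e x c, last x c = y, uniq (x :: c), {subset x :: c <= Z} &
    size Z <= (size c).*2].
Proof.
move=> cZ uZ xZ yZ ne; have [i Z' Er] := rot_to xZ.
have sZ : size Z = (size Z').+1 by rewrite -(size_rot i) Er.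
have mZ z : (z \in Z) = (z \in x :: Z') by rewrite -(mem_rot i) Er.
have {}uZ : uniq (x :: Z') by rewrite -Er rot_uniq.
have {}cZ : cycle e (x :: Z') by rewrite -Er rot_cycle.
move: yZ; rewrite mZ inE eq_sym (negbTE ne) /= => /mem_split [Z1 [Z2 E]].
move: cZ; rewrite /= E rcons_cat /= -cat_rcons cat_path last_rcons => /andP [p1 p2].
have sz : size Z = size Z1 + size Z2 + 2 by rewrite sZ E size_cat /=; clear; lia.
have [ge|lt] := leqP (size Z2) (size Z1).
  exists (rcons Z1 y); split=> //.
  - by rewrite last_rcons.
  - by move: uZ; rewrite E -cat_rcons -cat_cons cat_uniq => /andP [].
  - by move=> z zz; rewrite mZ E -cat_rcons -cat_cons mem_cat zz.
  - by rewrite sz size_rcons; move: ge; move: (size Z1) (size Z2); clear; lia.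
exists (rcons (rev Z2) y); split=> //.
- have : sorted e (rev (y :: rcons Z2 x)) by rewrite sorted_rev.
  by rewrite rev_cons rev_rcons.
- by rewrite last_rcons.
- move: uZ; rewrite E -rev_cons /= mem_rev rev_uniq mem_cat cat_uniq.
  by move=> /andP [/norP [_ ->] /and3P [_ _ ->]].
- move=> z; rewrite mZ E -rev_cons !(inE, mem_cat, mem_rev).
  by case/or3P=> ->; rewrite ?orbT.
- by rewrite sz size_rcons size_rev; move: lt; move: (size Z1) (size Z2); clear; lia.
Qed.

(** Many rungs lead from a heavy cycle to a longest path that avoids it; between
    two of them that land close together the longest path could be rerouted
    through the longer arc of the cycle. *)
Lemma light_cycle Z : cycle e Z -> uniq Z -> weight e Z < lpt e ->
  weight e Z * (weight e Z).-1 <= l.*2.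
Proof.
move=> cZ uZ /weight_avoid [Y lY YZ].
have ZY : ~~ has [in Y] Z by rewrite has_sym.
have nD : ~~ has [in [::]] Z by rewrite has_sym.
have wD : weight e [::] + weight e Z <= weight e Z.
  by have := weight_size e [::]; rewrite leqn0 => /eqP ->.
have [u [q [inn [rP _ disj]]]] := rungs lY ZY nD wD.
have := @rungs_spread Y Z _ u q inn (uphalf (weight e Z)) lY ZY rP disj _.
suff H : forall i j, i != j -> exists c, [/\ path e (u i) c, last (u i) c = u j,
     uniq (u i :: c), {subset u i :: c <= Z} &
     uphalf (weight e Z) <= size (inn i) + size (inn j) + size c + 2].
  by move=> /(_ H); move: (weight e Z) => w; clear; nia.
move=> i j ne.
have [ui _ _ _ _] := rP i; have [uj _ _ _ _] := rP j.
have neu : u i != u j.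
  by apply: contra ne => /eqP E; apply/eqP/(disj i j (u i)); rewrite ?E mem_head.
have [c [pc lc uc cZ' sc]] := longer_arc cZ uZ ui uj neu.
exists c; split=> //; have := weight_size e Z; move: sc.
by move: (weight e Z) (size Z) (size c); clear; lia.
Qed.

End Rungs.

(** * Branching light paths *)

Section Branching.
Context {T : finType} (e : rel T).
Context (e_sym : symmetric e).
Context (e_conn : connected_graph e).
Context (v : nat).
Context (v_large : (max_path_length e).*2 < v * v.-1).
Let k := lpt e.

(** The form in which [light_cycle] is used: [v] exceeds the weight of every
    light cycle, hence of all its parts. *)
Lemma heavy_cycle Z s : cycle e Z -> uniq Z -> weight e Z < k ->
  {subset s <= Z} -> weight e s < v.
Proof.
move=> cZ uZ wZ sZ; apply: leq_ltn_trans (weight_sub e sZ) _.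
have := leq_ltn_trans (light_cycle e_sym e_conn cZ uZ wZ) v_large.
rewrite !ltnNge; apply: contra => le.
by apply: leq_mul => //; rewrite -!subn1 leq_sub2r.
Qed.

Lemma first_occurrence (P : pred T) s : has P s ->
  exists s1 x s2, [/\ s = s1 ++ x :: s2, P x & ~~ has P s1].
Proof.
elim: s => //= a s IH; have [Pa _|nPa /IH [s1 [x [s2 [-> Px nP]]]]] := boolP (P a).
  by exists [::], a, s.
by exists (a :: s1), x, s2; rewrite /= negb_or nPa.
Qed.

Lemma cycle_chord x s u j : sorted e (x :: rcons s u) -> uniq (x :: rcons s u) ->
  path e u (rcons j x) -> uniq j -> ~~ has [in x :: rcons s u] j ->
  cycle e ((x :: rcons s u) ++ j) /\ uniq ((x :: rcons s u) ++ j).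
Proof.
move=> ps us pj uj dj; split; last by rewrite cat_uniq us dj.
by rewrite /= rcons_cat cat_path last_rcons pj andbT.
Qed.

(** A short path joining two vertices of a light path closes a light cycle. *)
Lemma no_light_chord E E1 x s u E2 j t :
  E = E1 ++ (x :: rcons s u) ++ E2 ->
  sorted e E -> uniq E -> weight e E + v < k ->
  path e u (rcons j x) -> uniq j -> ~~ has [in E] j -> size j <= v ->
  {subset t <= s} -> weight e t < v.
Proof.
move=> EE sE uE wE pj uj dj sj ts.
have [_ sE'] : sorted e E1 * sorted e ((x :: rcons s u) ++ E2).
  by apply: cat_sorted2; rewrite -EE.
have [sx _] := cat_sorted2 sE'.
have ux : uniq (x :: rcons s u).
  by move: uE; rewrite EE !cat_uniq => /and3P [_ _ /andP [-> _]].
have subE : {subset x :: rcons s u <= E}.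
  by move=> z zs; rewrite EE !mem_cat zs !orbT.
have dj' : ~~ has [in x :: rcons s u] j.
  by apply: contra dj => /hasP [z zj /subE zE]; apply/hasP; exists z.
have [cZ uZ] := cycle_chord sx ux pj uj dj'.
apply: (heavy_cycle cZ uZ); last first.
  by move=> z /ts zs; rewrite mem_cat inE mem_rcons inE zs !orbT.
apply: leq_ltn_trans wE; apply: leq_trans (weight_cat _ _ _) _.
apply: leq_add (weight_sub e subE) _.
exact: leq_trans (weight_size _ _) sj.
Qed.

(** The guards [V] and [V'] on both sides of [M] are deleted before Menger's
    theorem is applied, so the rungs do not use them; this costs at most
    [weight e V + weight e V'] of the [weight e M] rungs.  A short rung that
    reached the path beyond a guard would be a chord enclosing the guard, so it
    avoids the whole path.  The empty alternatives are for the end of the path. *)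
Lemma short_rung A V M V' B Y :
  let E := A ++ V ++ M ++ V' ++ B in
  sorted e E -> uniq E -> weight e E + v < k ->
  A = [::] \/ v <= weight e V -> B = [::] \/ v <= weight e V' ->
  weight e V + weight e V' + v <= weight e M ->
  longest_path e Y -> ~~ has [in Y] M ->
  exists M1 u M2 i q,
    [/\ M = M1 ++ u :: M2, q \in Y & size i <= v] /\
    [/\ path e q (rcons i u), uniq (q :: i), ~~ has [in Y] i &
        ~~ has [in E] (q :: i)].
Proof.
move=> E sE uE wE hV hV' hM lY YM.
have nD : ~~ has [in V ++ V'] M.
  move: uE; rewrite /E catA cat_uniq => /and3P [_ n1 uM].
  rewrite has_sym has_cat negb_or; apply/andP; split.
    rewrite has_sym; apply/hasPn => z zM; move/hasPn: n1 => /(_ z).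
    by rewrite /= !mem_cat zM => /(_ isT) /norP [].
  move: uM; rewrite cat_uniq => /and3P [_ n2 _]; apply/hasPn => z zV.
  by move/hasPn: n2 => /(_ z); rewrite mem_cat zV => /(_ isT).
have wD : weight e (V ++ V') + v <= weight e M.
  by apply: leq_trans hM; rewrite leq_add2r weight_cat.
have [us [qs [inn [rP nDs disj]]]] := rungs e_sym e_conn lY YM nD wD.
have [i si] : exists i, size (inn i) <= v.
  apply: boolp.contrapT => no.
  have long i : v < size (inn i).
    by rewrite ltnNge; apply/negP => le; apply: no; exists i.
  (* If all rungs were longer than v, their landing points would be at pairwise
     distance at least 2 v, too much for v points on Y. *)
  have := @rungs_spread T e e_sym Y M v us qs inn (v + v) lY YM rP disj.
  suff H : forall i j, i != j -> exists c, [/\ path e (us i) c, last (us i) c = us j,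
     uniq (us i :: c), {subset us i :: c <= M} &
     v + v <= size (inn i) + size (inn j) + size c + 2].
    move=> /(_ H); move: v_large; clear; nia.
  move=> i j _; have [ui _ _ _ _] := rP i; have [uj _ _ _ _] := rP j.
  have sM : sorted e M.
    move: sE; rewrite /E => sE; have [_ sE1] := cat_sorted2 sE.
    by have [_ sE2] := cat_sorted2 sE1; have [] := cat_sorted2 sE2.
  have [p [pp lp ps]] := subwalk e_sym sM ui uj.
  move: lp.
  case/shortenP: pp => p' pp' up' sub' lp; exists p'; split=> //.
    move=> z; rewrite inE => /orP [/eqP -> //|/sub' zp].
    by apply: ps; rewrite inE zp orbT.
  have := long i; have := long j.
  by move: (size (inn i)) (size (inn j)) (size p'); clear; lia.
have [uM qY pi ui [iM iY]] := rP i; have := nDs i.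
move: (us i) (qs i) (inn i) uM qY pi ui iM iY si.
move=> {us qs inn rP nDs disj i} u q i uM qY pi ui iM iY si nDi.
have [M1 [M2 EM]] := mem_split uM.
exists M1, u, M2, (rev i), q; rewrite size_rev; split=> //.
have nE : ~~ has [in E] (rcons i q).
  apply/negP => /first_occurrence [j [x [j' [Ej xE nj]]]].
  have xi : x \in rcons i q by rewrite Ej mem_cat mem_head orbT.
  have xV := hasPn nDi x xi.
  have xM : x \notin M.
    move: xi; rewrite mem_rcons inE => /orP [/eqP ->|/(hasPn iM) //].
    by apply/negP => /(hasPn YM); rewrite /= qY.
  have pj : path e u (rcons j x).
    by move: pi; rewrite Ej -cat_rcons cat_path => /andP [].
  have uj : uniq j.
    by move: ui; rewrite Ej /= cat_uniq => /and3P [].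
  have sj : size j <= v.
    apply: leq_trans si; have := congr1 size Ej.
    by rewrite size_rcons size_cat /=; move: (size i) (size j) (size j'); clear; lia.
  move: xE xV xM; rewrite /E /= !mem_cat negb_or.
  move=> /or4P [xA|xV|xM|/orP [xV'|xB]] /andP [nV nV'] nM.
  - case: hV => [A0|hV]; first by rewrite A0 in xA.
    have [A1 [A2 EA]] := mem_split xA.
    have EE : E = A1 ++ (x :: rcons (A2 ++ V ++ M1) u) ++ (M2 ++ V' ++ B).
      by rewrite /E EA EM -!cats1 !(=^~ catA, cat_cons, cat0s).
    suff : weight e V < v by rewrite ltnNge hV.
    apply: (no_light_chord EE sE uE wE pj uj nj sj).
    by move=> z zV; rewrite !mem_cat zV orbT.
  - by rewrite xV in nV.
  - by rewrite xM in nM.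
  - by rewrite xV' in nV'.
  - case: hV' => [B0|hV']; first by rewrite B0 in xB.
    have [B1 [B2 EB]] := mem_split xB.
    have EE : E = (A ++ V ++ M1) ++ (u :: rcons (M2 ++ V' ++ B1) x) ++ B2.
      by rewrite /E EB EM -!cats1 !(=^~ catA, cat_cons, cat0s).
    suff : weight e V' < v by rewrite ltnNge hV'.
    apply: (no_light_chord (j := rev j) EE sE uE wE _);
      rewrite ?rev_uniq ?has_rev ?size_rev //.
      have : sorted e (rev (u :: rcons j x)) by rewrite sorted_rev.
      by rewrite rev_cons rev_rcons.
    by move=> z zV; rewrite !mem_cat zV orbT.
split.
- have : sorted e (rev (u :: rcons i q)) by rewrite sorted_rev.
  by rewrite rev_cons rev_rcons.
- by move: ui => /= /andP [_]; rewrite rcons_uniq mem_rev rev_uniq.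
- by rewrite has_rev.
- by move: nE; rewrite has_rcons /= has_rev.
Qed.

(** Adding one vertex raises the weight by at most one, so all smaller values
    occur among the suffixes. *)
Lemma weight_suffix s y : y <= weight e s ->
  exists s1 s2, s = s1 ++ s2 /\ weight e s2 = y.
Proof.
have w0 : weight e [::] = 0 by apply/eqP; rewrite -leqn0 weight_size.
elim: s => [|a s IH] ys.
  by exists [::], [::]; move: ys; rewrite w0 leqn0 => /eqP ->.
have [/IH [s1 [s2 [-> w2]]]|lt] := leqP y (weight e s); first by exists (a :: s1), s2.
exists [::], (a :: s); split=> //; apply/eqP; rewrite eqn_leq ys andbT.
apply: leq_trans (weight_cat e [:: a] s) _.
apply: leq_trans lt; rewrite -add1n leq_add2r.
exact: weight_size.
Qed.

(** The anatomy of a leg, from its tip to its root.  The part [M] must outweigh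
    both neighbouring guards by [v], and the tip [L] its only neighbour [V], in
    order that [short_rung] applies to them. *)
Lemma leg_split O : 7 * v <= weight e O -> exists L V M V',
  [/\ O = L ++ V ++ M ++ V', weight e V = v, weight e V' = v,
      3 * v <= weight e M & 2 * v <= weight e L].
Proof.
move=> wO.
have [|O1 [V' [E1 wV']]] := @weight_suffix O v; first by move: wO; clear; lia.
have := weight_cat e O1 V'; rewrite -E1 => w1.
have [|O2 [M [E2 wM]]] := @weight_suffix O1 (3 * v).
  by move: wO w1 wV'; move: (weight e O) (weight e O1) (weight e V'); clear; lia.
have := weight_cat e O2 M; rewrite -E2 => w2.
have [|L [V [E3 wV]]] := @weight_suffix O2 v.
  move: wO w1 wV' w2 wM.
  move: (weight e O) (weight e O1) (weight e O2) (weight e V') (weight e M).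
  by clear; lia.
have := weight_cat e L V; rewrite -E3 => w3.
exists L, V, M, V'; split=> //; first by rewrite E1 E2 E3 -!catA.
  by rewrite wM.
move: wO w1 wV' w2 wM w3 wV.
move: (weight e O) (weight e O1) (weight e O2) (weight e V') (weight e M).
by move: (weight e L) (weight e V); clear; lia.
Qed.

(** One of the two directions in which [Y] can be followed from [q] has at least
    half of the weight of [Y]. *)
Lemma leg Y q y : longest_path e Y -> q \in Y -> 0 < y -> y.*2 <= k ->
  exists O, [/\ sorted e (rcons O q), uniq (rcons O q),
    {subset rcons O q <= Y} & weight e (rcons O q) = y].
Proof.
move=> lY qY y0 yk; have [Y1 [Y2 EY]] := mem_split qY.
have [S [sS uS subS wS]] : exists S, [/\ sorted e (rcons S q), uniq (rcons S q),
    {subset rcons S q <= Y} & y <= weight e (rcons S q)].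
  have [s1 s2] : sorted e (rcons Y1 q) /\ sorted e (q :: Y2).
    by apply/andP; rewrite -sorted_glue -EY longest_sorted.
  have uY : uniq (Y1 ++ q :: Y2) by rewrite -EY (longest_uniq lY).
  have [w1|w1] := leqP y (weight e (rcons Y1 q)).
    exists Y1; split=> //; first by move: uY; rewrite -cat_rcons cat_uniq => /andP [].
    by move=> z zz; rewrite EY -cat_rcons mem_cat zz.
  exists (rev Y2); rewrite -rev_cons; split.
  - by rewrite sorted_rev.
  - by rewrite rev_uniq; move: uY; rewrite cat_uniq => /and3P [].
  - by move=> z; rewrite mem_rev EY mem_cat => ->; rewrite orbT.
  have sub : {subset q :: Y2 <= rev (q :: Y2)} by move=> z; rewrite mem_rev.
  have := weight_sub e sub; have := weight_cat e (rcons Y1 q) (q :: Y2).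
  have subY : {subset Y <= rcons Y1 q ++ q :: Y2}.
    move=> z; rewrite EY !mem_cat mem_rcons !inE => /or3P [] ->; by rewrite ?orbT.
  have := weight_sub e subY; have := weight_longest e_sym e_conn lY.
  rewrite -/k; move: yk w1; move: (weight e Y) (weight e (rcons Y1 q)).
  move: (weight e (q :: Y2)) (weight e (rev (q :: Y2))) (weight e (_ ++ _)).
  by clear; lia.
have [S1 [S2 [E2 w2]]] := weight_suffix wS.
case/lastP: S2 => [|O q'] in E2 w2.
  by have := weight_size e [::]; rewrite w2 leqNgt y0.
move: E2; rewrite -rcons_cat => /rcons_inj [ES Eq]; rewrite -Eq in w2.
have EE : rcons S q = S1 ++ rcons O q by rewrite ES rcons_cat.
exists O; split=> //.
- by move: sS; rewrite EE => /cat_sorted2 [].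
- by move: uS; rewrite EE cat_uniq => /and3P [].
- by move=> z zO; apply: subS; rewrite EE mem_cat zO orbT.
Qed.

(** With [x] the last vertex of [a0] on [b0], the two paths are disjoint between
    [x] and [c], so these parts close a cycle. *)
Lemma fork a0 b0 c s : sorted e (a0 ++ c :: s) -> uniq (a0 ++ c :: s) ->
  sorted e (b0 ++ c :: s) -> uniq (b0 ++ c :: s) -> has [in b0] a0 ->
  exists a1 x a2 b1 b2, [/\ a0 = a1 ++ x :: a2, b0 = b1 ++ x :: b2,
    cycle e (x :: a2 ++ c :: rev b2) & uniq (x :: a2 ++ c :: rev b2)].
Proof.
move=> sa ua sb ub; rewrite -has_rev => /first_occurrence [ra [x [ra1 [Ea xb na]]]].
have {}Ea : a0 = rev ra1 ++ x :: rev ra.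
  by rewrite -[a0]revK Ea rev_cat rev_cons cat_rcons.
have [b1 [b2 Eb]] := mem_split xb.
exists (rev ra1), x, (rev ra), b1, b2; split=> //.
  have pa : path e x (rcons (rev ra) c).
    move: sa; rewrite Ea -catA cat_cons sorted_glue => /andP [_].
    by rewrite /= -cat_rcons cat_path => /andP [].
  have pb : sorted e (rev (x :: rcons b2 c)).
    rewrite sorted_rev //; move: sb; rewrite Eb -catA cat_cons sorted_glue.
    by move=> /andP [_]; rewrite /= -cat_rcons cat_path => /andP [].
  rewrite /= -cat_rcons rcons_cat cat_path pa last_rcons.
  by move: pb; rewrite rev_cons rev_rcons.
have ux : uniq (x :: rcons (rev ra) c).
  move: ua; rewrite Ea -catA cat_cons cat_uniq => /and3P [_ _].
  by rewrite -cat_rcons -cat_cons cat_uniq => /andP [].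
rewrite -cat_rcons -cat_cons cat_uniq ux rev_uniq.
have ubx : uniq (x :: b2 ++ c :: s).
  by move: ub; rewrite Eb -catA cat_cons cat_uniq => /and3P [].
apply/and3P; split=> //; last first.
  by move: ubx => /= /andP [_]; rewrite cat_uniq => /andP [].
apply/hasPn => z; rewrite mem_rev => zb; rewrite /= inE mem_rcons inE mem_rev !negb_or.
apply/and3P; split.
- by apply/eqP => zx; move: ubx; rewrite /= mem_cat -zx zb.
- move: ubx; rewrite /= cat_uniq => /and4P [_ _ /norP [cb _] _].
  by apply: contra cb => /eqP <-.
- by apply/negP => /(hasPn na) /=; rewrite Eb mem_cat inE zb !orbT.
Qed.

Lemma subset_behind (s1 s2 a : seq T) z b : uniq (s1 ++ s2) -> s1 ++ s2 = a ++ z :: b ->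
  z \in s1 -> {subset s2 <= b}.
Proof.
move=> us E zs; have ia : index z (s1 ++ s2) = size a.
  move: us; rewrite E cat_uniq /= => /and3P [_ /norP [/negbTE za _] _].
  by rewrite index_cat za /= eqxx addn0.
have Eb : b = drop (size a).+1 (s1 ++ s2).
  by rewrite E -cat_rcons drop_size_cat // size_rcons.
move=> w ws; rewrite Eb -ia index_cat zs drop_cat.
case: ltnP => [_|le]; first by rewrite mem_cat ws orbT.
have lt : index z s1 < size s1 by rewrite index_mem.
have -> : (index z s1).+1 = size s1 by apply/eqP; rewrite eqn_leq lt le.
by rewrite subnn drop0.
Qed.

(** One round of growth: from the vertex [u] of the light path the short rung
    leads to [Y], and a new leg follows [Y] from there.  Paths are written with
    their tip first. *)
Lemma grow_leg E E1 u E2 i q Y : E = E1 ++ u :: E2 ->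
  sorted e E -> uniq E -> longest_path e Y -> ~~ has [in Y] E -> 0 < v -> 14 * v <= k ->
  q \in Y -> size i <= v -> path e q (rcons i u) -> uniq (q :: i) ->
  ~~ has [in Y] i -> ~~ has [in E] (q :: i) ->
  exists L V M V',
    [/\ weight e V = v, weight e V' = v, 3 * v <= weight e M & 2 * v <= weight e L] /\
    [/\ sorted e (L ++ V ++ M ++ V' ++ i ++ u :: E2),
        uniq (L ++ V ++ M ++ V' ++ i ++ u :: E2),
        weight e (L ++ V ++ M ++ V' ++ i ++ u :: E2) <= weight e E + 8 * v &
        ~~ has [in E] (V' ++ i)].
Proof.
move=> EE sE uE lY YE v0 vk qY si pi ui iY iE.
have [||O [sO uO subO wO]] := @leg Y q (7 * v) lY qY.
- by move: v0; clear; lia.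
- by move: vk; clear; lia.
have [|L [V [M [V' [EO wV wV' wM wL]]]]] := @leg_split (rcons O q).
  by rewrite wO.
have EN : L ++ V ++ M ++ V' ++ i ++ u :: E2 = rcons O q ++ i ++ u :: E2.
  by rewrite EO -!catA.
exists L, V, M, V'; split=> //; rewrite EN.
have nO : ~~ has [in E] (rcons O q).
  rewrite has_sym; apply: contra YE => /hasP [z zE /subO zY].
  by apply/hasP; exists z.
have niE : ~~ has [in E] i by move: iE; rewrite /= negb_or => /andP [].
have E2E z : z \in u :: E2 -> z \in E by rewrite EE mem_cat => ->; rewrite orbT.
split.
- rewrite cat_rcons sorted_glue sO /= -cat_rcons cat_path pi last_rcons.
  by move: sE; rewrite EE sorted_glue => /andP [].
- rewrite cat_uniq uO cat_uniq.
  have -> : uniq i by case/andP: ui.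
  have -> : uniq (u :: E2) by move: uE; rewrite EE cat_uniq => /and3P [].
  apply/and3P; split=> //.
    apply/hasPn => z; rewrite mem_cat => /orP [zi|/E2E zE]; apply/negP => /= zO.
      by move/hasPn: iY => /(_ _ zi) /=; rewrite subO.
    by move/hasPn: nO => /(_ _ zO) /=; rewrite zE.
  rewrite andbT; apply/hasPn => z /E2E zE; apply/negP => /= zi.
  by move/hasPn: niE => /(_ _ zi) /=; rewrite zE.
- apply: leq_trans (weight_cat _ _ _) _; rewrite wO.
  have := weight_cat e i (u :: E2); have := leq_trans (weight_size e i) si.
  have := weight_sub e E2E.
  move: (weight e (u :: E2)) (weight e E) (weight e i) (weight e (i ++ _)).
  by clear; lia.
- rewrite has_cat negb_or niE andbT.
  by move: nO; rewrite EO !has_cat !negb_or => /and4P [].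
Qed.

(** The new paths keep the part [V' ++ B], in particular the guard [V'] at the
    root of the leg.  This makes the two subtrees grown from [M] and from [L]
    disjoint: where their paths meet first after branching at [u1], either the
    first path has already passed the guard [Va'] of its own leg, or the second
    one has passed [V] on the way from [u1] to its branch point in [L].  Each
    round costs [7 * v] for a leg and [v] for a rung; the final [2 * v] pays for
    the rung to [W]. *)
Lemma binary_tree W c m : longest_path e W -> c.*2 < k -> 14 * v <= k ->
  forall L V M V' B, let E := L ++ V ++ M ++ V' ++ B in
  sorted e E -> uniq E -> weight e V = v -> weight e V' = v ->
  3 * v <= weight e M -> 2 * v <= weight e L ->
  weight e E + 8 * v * m + 2 * v <= c ->
  exists F, [/\ size F = 2 ^ m, uniq F, {subset F <= W} &
    forall x, x \in F -> exists X, [/\ sorted e (x :: X ++ V' ++ B),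
      uniq (x :: X ++ V' ++ B) & weight e (x :: X ++ V' ++ B) <= c]].
Proof.
move=> lW ck vk.
have v0 : 0 < v by move: v_large; clear; case: v.
elim: m => [|m IH] L V M V' B E sE uE wV wV' wM wL wE.
  have wE' : weight e E + v < k by move: ck wE v0; move: (weight e E); clear; lia.
  have [WM|WM] := boolP (has [in W] M).
    have [x xM xW] := hasP WM; have [M1 [M2 EM]] := mem_split xM.
    exists [:: x]; split=> // [z|z]; rewrite inE => /eqP -> //.
    have EE : E = (L ++ V ++ M1) ++ x :: M2 ++ V' ++ B by rewrite /E EM -!catA.
    exists M2; split.
    - by move: sE; rewrite EE => /cat_sorted2 [].
    - by move: uE; rewrite EE cat_uniq => /and3P [].
    apply: leq_trans wE; rewrite muln0 addn0; apply: leq_trans (leq_addr _ _).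
    by apply: weight_sub => y yx; rewrite EE mem_cat yx orbT.
  have [|||M1 [u [M2 [i [q [[EM qW si] [pi ui iW iE]]]]]]] :=
    short_rung sE uE wE' _ _ _ lW WM.
  - by right; rewrite wV.
  - by right; rewrite wV'.
  - by rewrite wV wV'; move: wM; clear; lia.
  exists [:: q]; split=> // [z|z]; rewrite inE => /eqP -> //.
  have EE : E = (L ++ V ++ M1) ++ u :: M2 ++ V' ++ B by rewrite /E EM -!catA.
  exists (i ++ u :: M2); rewrite -catA; split.
  - rewrite /= -cat_rcons cat_path pi last_rcons.
    by move: sE; rewrite EE sorted_glue => /andP [].
  - rewrite -cat_cons cat_uniq ui.
    have -> : uniq (u :: M2 ++ V' ++ B) by move: uE; rewrite EE cat_uniq => /and3P [].
    rewrite andbT; apply: contra iE => /hasP [y yM yi]; apply/hasP; exists y => //.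
    by rewrite /= -/E EE mem_cat yM orbT.
  apply: leq_trans wE; rewrite -cat_cons; apply: leq_trans (weight_cat _ _ _) _.
  have : weight e ((u :: M2) ++ V' ++ B) <= weight e E.
    by apply: weight_sub => y yM; rewrite EE mem_cat yM orbT.
  have : weight e (q :: i) <= v.+1 by apply: leq_trans (weight_size _ _) _.
  move: (weight e (q :: i)) (weight e (_ ++ _)) (weight e E) v0.
  by clear; lia.
have wE' : weight e E + v < k by move: ck wE v0; move: (weight e E); clear; nia.
have [Y lY EY] : exists2 Y, longest_path e Y & ~~ has [in E] Y.
  by apply: weight_avoid; apply: leq_ltn_trans wE'; rewrite leq_addr.
have YE : ~~ has [in Y] E by rewrite has_sym.
have subY s : {subset s <= E} -> ~~ has [in Y] s.
  by move=> sub; apply: contra YE => /hasP [z /sub zE zY]; apply/hasP; exists z.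
have YM : ~~ has [in Y] M by apply: subY => z zM; rewrite /E !mem_cat zM !orbT.
have YL : ~~ has [in Y] L by apply: subY => z zL; rewrite /E !mem_cat zL.
have [|||M1 [u1 [M2 [i1 [q1 [[EM q1Y si1] [pi1 ui1 iY1 iE1]]]]]]] :=
  short_rung sE uE wE' _ _ _ lY YM.
- by right; rewrite wV.
- by right; rewrite wV'.
- by rewrite wV wV'; move: wM; clear; lia.
have w0 : weight e [::] = 0 by apply/eqP; rewrite -leqn0 weight_size.
have [|||L1 [u2 [L2 [i2 [q2 [[EL q2Y si2] [pi2 ui2 iY2 iE2]]]]]]] :=
  @short_rung [::] [::] L V (M ++ V' ++ B) Y sE uE wE' _ _ _ lY YL.
- by left.
- by right; rewrite wV.
- by rewrite w0 wV; move: wL; clear; lia.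
have EE1 : E = (L ++ V ++ M1) ++ u1 :: M2 ++ V' ++ B by rewrite /E EM -!catA.
have EE2 : E = L1 ++ u2 :: L2 ++ V ++ M ++ V' ++ B by rewrite /E EL -!catA.
(* The first child leaves at u1 in M, the second one at u2 in L. *)
have [La [Va [Ma [Va' [[wVa wVa' wMa wLa] [sa ua wa na]]]]]] :=
  grow_leg EE1 sE uE lY YE v0 vk q1Y si1 pi1 ui1 iY1 iE1.
have [Lb [Vb [Mb [Vb' [[wVb wVb' wMb wLb] [sb ub wb _]]]]]] :=
  grow_leg EE2 sE uE lY YE v0 vk q2Y si2 pi2 ui2 iY2 iE2.
have budget w : w <= weight e E + 8 * v -> w + 8 * v * m + 2 * v <= c.
  by move: wE; move: (weight e E); clear; nia.
have [F1 [sF1 uF1 WF1 pF1]] := IH _ _ _ _ _ sa ua wVa wVa' wMa wLa (budget _ wa).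
have [F2 [sF2 uF2 WF2 pF2]] := IH _ _ _ _ _ sb ub wVb wVb' wMb wLb (budget _ wb).
exists (F1 ++ F2); split.
- by rewrite size_cat sF1 sF2 addnn -mul2n -expnS.
- rewrite cat_uniq uF1 uF2 andbT /=; apply/hasPn => x xF2; apply/negP => /= xF1.
  have [X1 [sX1 uX1 wX1]] := pF1 x xF1; have [X2 [sX2 uX2 wX2]] := pF2 x xF2.
  pose a0 := (x :: X1) ++ Va' ++ i1.
  pose b0 := ((x :: X2) ++ Vb' ++ i2 ++ u2 :: L2) ++ V ++ M1.
  pose S := M2 ++ V' ++ B.
  have Ea : x :: X1 ++ Va' ++ i1 ++ u1 :: M2 ++ V' ++ B = a0 ++ u1 :: S.
    by rewrite /a0 /S !(=^~ catA, cat_cons).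
  have Eb : x :: X2 ++ Vb' ++ i2 ++ u2 :: L2 ++ V ++ M ++ V' ++ B = b0 ++ u1 :: S.
    by rewrite /b0 /S EM !(=^~ catA, cat_cons).
  rewrite Ea in sX1 uX1 wX1; rewrite Eb in sX2 uX2 wX2.
  (* Both paths end with u1 :: S; before that they share x. *)
  have [|a1 [z [a2 [b1 [b2 [Ea0 Eb0 cZ uZ]]]]]] := fork sX1 uX1 sX2 uX2.
    by apply/hasP; exists x; rewrite /= ?mem_head.
  set Z := z :: _ in cZ uZ.
  have wZ : weight e Z < k.
    apply: leq_ltn_trans ck; rewrite -addnn.
    apply: leq_trans (leq_add wX1 wX2); apply: leq_trans (weight_cat _ _ _).
    apply: weight_sub => w; rewrite /Z Ea0 Eb0 !(inE, mem_cat) mem_rev.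
    by case/or4P=> ->; rewrite ?orbT.
  have ua0 : uniq a0 by move: uX1; rewrite cat_uniq => /and3P [].
  have ub0 : uniq b0 by move: uX2; rewrite cat_uniq => /and3P [].
  have : z \in a0 by rewrite Ea0 mem_cat mem_head orbT.
  rewrite /a0 mem_cat => /orP [zX|zV].
    have sub := subset_behind ua0 Ea0 zX.
    have : weight e Va' < v.
      apply: (heavy_cycle cZ uZ wZ) => w wV1; rewrite /Z inE mem_cat sub ?orbT //.
      by rewrite mem_cat wV1.
    by rewrite wVa' ltnn.
  have zE : z \notin E by move/hasPn: na => /(_ _ zV).
  have zb : z \in (x :: X2) ++ Vb' ++ i2 ++ u2 :: L2.
    have : z \in b0 by rewrite Eb0 mem_cat mem_head orbT.
    rewrite /b0 mem_cat => /orP [//|zVM]; exfalso; apply/negP: zE; rewrite negbK.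
    by move: zVM; rewrite /E EM !mem_cat => /orP [] ->; rewrite ?orbT.
  have sub := subset_behind ub0 Eb0 zb.
  have : weight e V < v.
    apply: (heavy_cycle cZ uZ wZ) => w wV1.
    by rewrite /Z !(inE, mem_cat) mem_rev sub ?orbT // mem_cat wV1.
  by rewrite wV ltnn.
- by move=> x; rewrite mem_cat => /orP [/WF1|/WF2].
move=> x; rewrite mem_cat => /orP [xF|xF].
  have [X [sX uX wX]] := pF1 x xF; exists (X ++ Va' ++ i1 ++ u1 :: M2).
  have -> : (X ++ Va' ++ i1 ++ u1 :: M2) ++ V' ++ B =
    X ++ Va' ++ i1 ++ u1 :: M2 ++ V' ++ B by rewrite !(=^~ catA, cat_cons).
  by [].
have [X [sX uX wX]] := pF2 x xF; exists (X ++ Vb' ++ i2 ++ u2 :: L2 ++ V ++ M).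
have -> : (X ++ Vb' ++ i2 ++ u2 :: L2 ++ V ++ M) ++ V' ++ B =
  X ++ Vb' ++ i2 ++ u2 :: L2 ++ V ++ M ++ V' ++ B by rewrite !(=^~ catA, cat_cons).
by [].
Qed.

(** The tree starts from a leg of [W] itself; a pair of its paths has weight at
    most twice the budget. *)
Theorem lpt_bound m : 0 < #|T| -> max_path_length e < (2 ^ m).-1 ->
  k <= 2 * (9 * v + 8 * v * m).
Proof.
move=> T0 lm; rewrite leqNgt; apply/negP => ck.
have v0 : 0 < v by move: v_large; clear; case: v.
have [W lW] := exists_longest_path e T0.
have vk : 14 * v <= k by move: ck; clear; nia.
have wW : 7 * v <= weight e W.
  by apply: leq_trans (weight_longest e_sym e_conn lW); move: vk; rewrite /k; clear; lia.
have [W1 [E [EW wE]]] := weight_suffix wW.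
have [|L [V [M [V' [EE wV wV' wM wL]]]]] := @leg_split E; first by rewrite wE.
have sE : sorted e E by have := longest_sorted lW; rewrite EW => /cat_sorted2 [].
have uE : uniq E by have := longest_uniq lW; rewrite EW cat_uniq => /and3P [].
have [] := @binary_tree W (9 * v + 8 * v * m) m lW _ vk L V M V' [::] _ _ wV wV' wM wL.
- by move: ck; clear; lia.
- by rewrite cats0 -EE.
- by rewrite cats0 -EE.
- by rewrite cats0 -EE wE; clear; lia.
move=> F [sF uF FW _].
have := uniq_leq_size uF FW; rewrite sF (longest_size lW).
by move: lm; move: (2 ^ m); clear; lia.
Qed.

End Branching.

(** * Growth estimates *)

Import Order.TTheory GRing.Theory Num.Theory.
Local Open Scope ring_scope.

Lemma exp_geq_linear (R : realType) (a : R) n : 0 <= a -> n%:R * a <= (1 + a) ^+ n.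
Proof.
move=> a0; suff : 1 + n%:R * a <= (1 + a) ^+ n by apply: le_trans; lra.
elim: n => [|n IH]; first by rewrite expr0; lra.
rewrite exprS -natr1.
have : (1 + a) * (1 + n%:R * a) <= (1 + a) * (1 + a) ^+ n by rewrite ler_wpM2l //; lra.
have : 0 <= n%:R * a * a by rewrite !mulr_ge0.
lra.
Qed.

(** Logarithms grow more slowly than powers, in the shape needed for the bound
    [lpt_bound]: the exponent [n] is at most of the order of [log2 l]. *)
Lemma log_leq_powR (R : realType) (t : R) : 0 < t -> exists2 K : R, 0 < K &
  forall l n : nat, (0 < l)%N -> (2 ^ n <= l.*2)%N -> 64 * (n%:R + 3) <= K * l%:R `^ t.
Proof.
move=> t0; pose a : R := 2 `^ t - 1.
have a0 : 0 < a.
  rewrite subr_gt0 -[X in X < _](powRr0 (2 : R)) /powR.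
  rewrite !ifN ?pnatr_eq0 // mul0r ltr_expR mulr_gt0 // ln_gt0 //.
  by rewrite ltr1n.
exists (64 * (2 `^ t / a + 3)) => [|l n l0 ln].
  by have := divr_ge0 (powR_ge0 2 t) (ltW a0); lra.
have L1 : 1 <= (l%:R : R) by rewrite ler1n.
have Lt : 1 <= (l%:R : R) `^ t.
  by have := ler_powR L1 (ltW t0); rewrite powRr0.
have na : n%:R * a <= 2 `^ t * l%:R `^ t.
  apply: le_trans (exp_geq_linear n (ltW a0)) _.
  rewrite addrC subrK -powRM // -powR_mulrn ?powR_ge0 // -powRrM mulrC powRrM.
  rewrite powR_mulrn // ge0_ler_powR ?nnegrE ?exprn_ge0 ?mulr_ge0 ?(ltW t0) //.
  by rewrite -natrX -natrM ler_nat mul2n.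
have : n%:R <= 2 `^ t / a * l%:R `^ t.
  by rewrite mulrAC ler_pdivlMr.
nra.
Qed.

Theorem theorem1p2 (R : realType) (eps : R) (eps_gt0 : 0 < eps) :
  exists l0 : nat, forall (T : finType) (e : rel T),
    simple_graph e -> connected_graph e -> (2 <= #|T|)%N ->
    (l0 <= max_path_length e)%N ->
    (lpt e)%:R <= (max_path_length e)%:R `^ (2^-1 + eps).
Proof.
have t0 : 0 < eps / 2 by rewrite divr_gt0.
have [K K0 HK] := log_leq_powR t0.
(* The choice of l0 makes K at most l `^ (eps / 2). *)
exists (Num.truncn (K `^ (eps / 2)^-1)).+1 => T e [e_sym _] e_conn T2.
set l := max_path_length e => ll.
have l_gt0 : (0 < l)%N by apply: leq_ltn_trans ll.
have L1 : 1 <= (l%:R : R) by rewrite ler1n.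
have powLD (x y : R) : l%:R `^ (x + y) = l%:R `^ x * l%:R `^ y.
  by rewrite powRD //; apply/implyP => _; rewrite pnatr_eq0 -lt0n.
pose s : R := l%:R `^ 2^-1.
have s2 : s * s = l%:R.
  rewrite /s -powLD; have -> : 2^-1 + 2^-1 = 1 :> R by field.
  by rewrite powRr1.
have s1 : 1 <= s.
  have h0 : 0 <= (2^-1 : R) by rewrite invr_ge0.
  by have := ler_powR L1 h0; rewrite powRr0.
(* v = w + 2 is between 2 sqrt l and 4 sqrt l. *)
pose w := Num.truncn (2 * s).
have w_le : (w%:R : R) <= 2 * s by rewrite truncn_le; lra.
have w_gt : 2 * s < w%:R + 1 by rewrite natr1 truncnS_gt.
have v_large : (l.*2 < w.+2 * w.+2.-1)%N.
  rewrite -(ltr_nat R) -muln2 !natrM -!natr1; nra.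
pose n := trunc_log 2 l.+1.
have /andP [n_le n_gt] := trunc_log_bounds (isT : 1 < 2)%N (ltn0Sn l).
have lm : (max_path_length e < (2 ^ n.+1).-1)%N.
  by move: n_gt; rewrite -/n -/l; case: (2 ^ n.+1)%N.
have T0 : (0 < #|T|)%N by apply: leq_trans T2.
have := lpt_bound e_sym e_conn v_large T0 lm.
have nl : (2 ^ n <= l.*2)%N.
  by apply: leq_trans n_le _; move: l_gt0; clear; lia.
have := HK l n l_gt0 nl => log_n.
have KL : K <= l%:R `^ (eps / 2).
  have -> : K = (K `^ (eps / 2)^-1) `^ (eps / 2).
    by rewrite -powRrM mulVf ?powRr1 ?ltW // gt_eqF.
  apply: ge0_ler_powR; rewrite ?nnegrE ?powR_ge0 ?(ltW t0) ?ler0n //.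
  by apply/ltW; apply: lt_le_trans (truncnS_gt _) _; rewrite ler_nat.
have -> : l%:R `^ (2^-1 + eps) = s * (l%:R `^ (eps / 2) * l%:R `^ (eps / 2)).
  by rewrite /s -!powLD -splitr.
rewrite -(ler_nat R) -(addn2 w) -(addn1 n) !(natrM, natrD) => k_le.
apply: le_trans k_le _.
set p := _ `^ (eps / 2) in log_n KL *.
have p0 : 0 <= p by exact: powR_ge0.
have : 64 * (n%:R + 3) <= p * p by apply: le_trans log_n _; rewrite ler_wpM2r.
have : 0 <= (n%:R : R) by [].
move: (w%:R) (n%:R) (p * p) w_le s1 => W N P wle s1 N0 NP.
have : s * (64 * (N + 3)) <= s * P by rewrite ler_wpM2l //; lra.
have : W * N <= 2 * s * N by rewrite ler_wpM2r.
have : N <= s * N by rewrite ler_peMl.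
lra.
Qed.
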